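(* Let $U\ge 1$, $n\ge1$ and $k\ge Un$ be integers. For each user $j=1,\dots,U$ let $\mathbf{L}_j\subseteq M_{n\times k}(\mathbb{C})$ be a lattice of full rank $r=2kn$ (as a lattice in the real vector space $M_{n\times k}(\mathbb{C})\cong\mathbb{R}^{2kn}$) with $\mathbb{Z}$-basis $B_{j,1},\dots,B_{j,r}$, and for a positive integer $N_j$ put $$\mathbf{L}_j(N_j)=\Big\{\sum_{i=1}^r b_iB_{j,i}\;:\; b_i\in\mathbb{Z},\ -N_j\le b_i\le N_j\Big\}.$$ Define $$\mathfrak{D}(N_1,\dots,N_U)=\min_{X_j\in\mathbf{L}_j(N_j)\setminus\{0\},\ j=1,\dots,U}\det(MM^{\dagger}),$$ where $M=M(X_1,\dots,X_U)$ is the $Un\times k$ matrix obtained by stacking $X_1,\dots,X_U$ vertically (rows of $X_1$ first, then those of $X_2$, etc.), and write $\mathfrak{D}(N)=\mathfrak{D}(N,\dots,N)$. Then there is a constant $K>0$, depending on the lattices $\mathbf{L}_1,\dots,\mathbf{L}_U$ (and on $n,k,U$) but not on $N_1,\dots,N_U$, such that for all positive integers $N_1,\dots,N_U$, $$\mathfrak{D}(N_1,\dots,N_U)\le K\prod_{l=1}^{U-1}N_l^{-\frac{2n^2(U-l)}{k-n(U-l)}},$$ and in particular $\mathfrak{D}(N)\le K/N^{\alpha}$ with $\alpha=\sum_{l=1}^{U-1}\frac{2n^2(U-l)}{k-n(U-l)}$. In the special case $k=Un$ this reads $$\mathfrak{D}(N_1,\dots,N_U)\le K\prod_{l=1}^{U-1}N_l^{-\frac{2n(U-l)}{l}},\qquad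 \mathfrak{D}(N)\le \frac{K}{N^{\beta}},\quad \beta=\sum_{l=1}^{U-1}\frac{2n(U-l)}{l}.$$
   Context: $M_{n\times k}(\mathbb{C})$ is the space of complex $n\times k$ matrices, regarded as a real vector space of dimension $2nk$. For a complex matrix $X$, $X^{\dagger}$ denotes its conjugate transpose. The tuple $(\mathbf{L}_1(N_1),\dots,\mathbf{L}_U(N_U))$ is called a $U$-user MIMO-MAC lattice code and $\mathfrak{D}$ its decay function. *)

(* Defs.v *)
(* Complex scalars: an arbitrary numClosedFieldType C
   (an algebraically closed field with conjugation and the induced order,
   the MathComp abstraction of the complex numbers); real scalars are the
   elements x with x \is Num.real. *)
From HB Require Import structures.
From mathcomp Require Import all_boot all_order all_algebra all_field.
Set Implicit Arguments. Unset Strict Implicit. Unset Printing Implicit Defensive.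
Import Order.TTheory GRing.Theory Num.Theory.
Local Open Scope ring_scope.

Definition ctrmx (C : numClosedFieldType) (m p : nat) (A : 'M[C]_(m, p)) : 'M[C]_(p, m) :=
  (map_mx Num.conj A)^T.

Definition real_lin_indep (C : numClosedFieldType) (m p r : nat)
  (B : 'I_r -> 'M[C]_(m, p)) : Prop :=
  forall a : 'I_r -> C, (forall i, a i \is Num.real) ->
    \sum_(i < r) a i *: B i = 0 -> forall i, a i = 0.

Definition in_box (C : numClosedFieldType) (m p r : nat)
  (B : 'I_r -> 'M[C]_(m, p)) (N : nat) (X : 'M[C]_(m, p)) : Prop :=
  exists b : 'I_r -> int, (forall i, (absz (b i) <= N)%N) /\
    X = \sum_(i < r) (b i)%:~R *: B i.

Definition stack (C : numClosedFieldType) (U n k : nat) (X : 'I_U -> 'M[C]_(n, k)) :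
  'M[C]_(\sum_(j < U) n, k) := \mxcol_(j < U) X j.

Definition gram_det (C : numClosedFieldType) (U n k : nat) (X : 'I_U -> 'M[C]_(n, k)) : C :=
  \det (stack X *m ctrmx (stack X)).

Definition is_decay (C : numClosedFieldType) (U n k r : nat)
  (B : 'I_U -> 'I_r -> 'M[C]_(n, k)) (N : 'I_U -> nat) (d : C) : Prop :=
  (exists X : 'I_U -> 'M[C]_(n, k),
      (forall j, X j != 0 /\ in_box (B j) (N j) (X j)) /\ d = gram_det X) /\
  (forall X : 'I_U -> 'M[C]_(n, k),
      (forall j, X j != 0 /\ in_box (B j) (N j) (X j)) -> d <= gram_det X).

(* x^e for a rational exponent e (x a positive real):
   the denominator-th (nonnegative real) root of x^(numerator) *)
Definition ratpow (C : numClosedFieldType) (x : C) (e : rat) : C :=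
  (absz (denq e)).-root (x ^ numq e).

(* exponent 2 n^2 (U - l) / (k - n (U - l)) for the 1-based user l = l0 + 1,
   where l0 : 'I_U is the 0-based index *)
Definition expo (U n k l0 : nat) : rat :=
  (2 * n ^ 2 * (U - l0.+1))%N%:R / (k - n * (U - l0.+1))%N%:R.

(* Main.v *)
(* The codewords are chosen from the last user to the first. Let A be the stack
   of the a = n(U - l) rows already chosen, put p = k - a, and let S be a p x k
   matrix with orthonormal rows orthogonal to those of A. Putting X on top of A
   multiplies the Gram determinant by that of the n x p matrix P = X S^H, where
   ^H is the conjugate transpose. The r = 2kn lattice generators turn the entries
   of P into np complex linear forms in r integer unknowns, so Siegel's pigeonhole
   argument gives a nonzero X in the box of size N for which they are
   O(N^(1 - r/(2np))) = O(N^(-a/p)), and the Gram determinant of P is then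
   O(N^(-2na/p)). *)
Require Import Defs.
From HB Require Import structures.
From mathcomp Require Import all_boot all_order all_fingroup all_algebra all_field.
From mathcomp Require Import zify ring.
Set Implicit Arguments. Unset Strict Implicit. Unset Printing Implicit Defensive.
Import Order.TTheory GRing.Theory Num.Theory.
Local Open Scope ring_scope.

Lemma mulr_absz_denq (e : rat) : e * (absz (denq e))%:R = (numq e)%:~R.
Proof. by rewrite pmulrn gez0_abs ?denq_ge0 // numqE. Qed.

Section RationalPowers.
Variables (C : numClosedFieldType) (x : C).
Hypothesis x_gt0 : 0 < x.
Implicit Types e f : rat.

Lemma ratpow_gt0 e : 0 < ratpow x e.
Proof. by rewrite /ratpow rootC_gt0 ?absz_gt0 ?denq_neq0 // exprz_gt0. Qed.

Lemma ratpow_ge0 e : 0 <= ratpow x e.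
Proof. exact: ltW (ratpow_gt0 e). Qed.

Lemma ratpow_expn e (p : int) (q : nat) :
  e * q%:R = p%:~R -> ratpow x e ^+ q = x ^ p.
Proof.
move=> eqp; set D := absz (denq e).
have D_gt0 : (0 < D)%N by rewrite absz_gt0 denq_neq0.
apply/eqP; rewrite -(eqrXn2 D_gt0) ?exprn_ge0 ?ratpow_ge0 ?exprz_ge0 ?ltW //.
rewrite exprAC /ratpow rootCK // !exprnP !exprz_exp; apply/eqP; congr (x ^ _).
by apply/(@intr_inj rat); rewrite !intrM -eqp -mulr_absz_denq mulrAC.
Qed.

Lemma eq_ratpow e (p : int) (q : nat) (y : C) :
  (0 < q)%N -> e * q%:R = p%:~R -> 0 <= y -> y ^+ q = x ^ p -> ratpow x e = y.
Proof.
move=> q_gt0 eqp y_ge0 yq; apply/eqP.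
by rewrite -(eqrXn2 q_gt0) ?ratpow_ge0 // yq (ratpow_expn eqp).
Qed.

Lemma ratpow0 : ratpow x 0 = 1.
Proof. by apply: (@eq_ratpow 0 0 1); rewrite ?mul0r. Qed.

Lemma ratpow1 : ratpow x 1 = x.
Proof. by apply: (@eq_ratpow 1 1 1); rewrite ?mul1r ?ltW. Qed.

Lemma ratpowD e f : ratpow x (e + f) = ratpow x e * ratpow x f.
Proof.
pose a := absz (denq e); pose b := absz (denq f).
have eab : e * (a * b)%:R = (numq e * b)%:~R.
  by rewrite natrM mulrA mulr_absz_denq intrM.
have fab : f * (a * b)%:R = (numq f * a)%:~R.
  by rewrite natrM mulrCA mulr_absz_denq intrM mulrC.
apply: (@eq_ratpow _ (numq e * b + numq f * a) (a * b)).
- by rewrite muln_gt0 !absz_gt0 !denq_neq0.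
- by rewrite mulrDl eab fab intrD.
- by rewrite mulr_ge0 ?ratpow_ge0.
by rewrite exprMn (ratpow_expn eab) (ratpow_expn fab) expfzDr ?gt_eqF.
Qed.

Lemma ratpowN e : ratpow x (- e) = (ratpow x e)^-1.
Proof.
by apply/esym/(@mulr1_eq _ (ratpow x e)); rewrite -ratpowD subrr ratpow0.
Qed.

Lemma ratpowB e f : ratpow x (e - f) = ratpow x e / ratpow x f.
Proof. by rewrite ratpowD ratpowN. Qed.

Lemma ratpow_sum (I : Type) (s : seq I) (P : pred I) (F : I -> rat) :
  ratpow x (\sum_(i <- s | P i) F i) = \prod_(i <- s | P i) ratpow x (F i).
Proof. exact: (big_morph _ ratpowD ratpow0). Qed.

Lemma ratpowMn e m : ratpow x (e *+ m) = ratpow x e ^+ m.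
Proof.
by rewrite -[m in LHS]card_ord -sumr_const ratpow_sum prodr_const card_ord.
Qed.

Lemma ler_ratpowl (m q : nat) (y : C) : (0 < q)%N -> 0 <= y ->
  (ratpow x (m%:R / q%:R) <= y) = (x ^+ m <= y ^+ q).
Proof.
move=> q_gt0 y_ge0; rewrite -(ler_pXn2r q_gt0) ?nnegrE ?ratpow_ge0 //.
by rewrite (@ratpow_expn _ m) // divfK // pnatr_eq0 -lt0n.
Qed.

End RationalPowers.

Lemma row_free_col_mxr (F : fieldType) m1 m2 n (X : 'M[F]_(m1, n)) (A : 'M_(m2, n)) :
  row_free (col_mx X A) -> row_free A.
Proof.
move=> /eqP rXA; rewrite /row_free eqn_leq rank_leq_row /= -(leq_add2l m1) -rXA.
by rewrite -addsmxE (leq_trans (mxrank_adds_leqif X A)) // leq_add2r rank_leq_row.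
Qed.

Lemma norm_det_le (R : numDomainType) n (A : 'M[R]_n) (c : R) :
  (forall i j, `|A i j| <= c) -> `|\det A| <= n`!%:R * c ^+ n.
Proof.
move=> leA; apply: le_trans (ler_norm_sum _ _ _) _.
rewrite -card_Sn mulr_natl -sumr_const; apply: ler_sum => s _.
rewrite normrM normrX normrN1 expr1n mul1r normr_prod.
rewrite -[n in leRHS]card_ord -prodr_const; apply: ler_prod => i _.
by rewrite normr_ge0 leA.
Qed.

Section GramDeterminant.
Variable C : numClosedFieldType.

Definition gram_mx m n (A : 'M[C]_(m, n)) : 'M[C]_m := A *m ctrmx A.

Lemma ctrmxM m n p (A : 'M[C]_(m, n)) (B : 'M_(n, p)) :
  ctrmx (A *m B) = ctrmx B *m ctrmx A.
Proof. by rewrite /ctrmx map_mxM trmx_mul. Qed.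

Lemma ctrmxK m n : cancel (@ctrmx C m n) (@ctrmx C n m).
Proof. by move=> A; apply/matrixP=> i j; rewrite !mxE conjCK. Qed.

Lemma ctrmx0 m n : ctrmx (0 : 'M[C]_(m, n)) = 0.
Proof. by rewrite /ctrmx map_mx0 trmx0. Qed.

Lemma ctrmx_col_mx m1 m2 n (A : 'M[C]_(m1, n)) (B : 'M_(m2, n)) :
  ctrmx (col_mx A B) = row_mx (ctrmx A) (ctrmx B).
Proof. by rewrite /ctrmx map_col_mx tr_col_mx. Qed.

Lemma unitary_gram_mxP m n (S : 'M[C]_(m, n)) :
  reflect (gram_mx S = 1%:M) (S \is unitarymx).
Proof. by rewrite /gram_mx /ctrmx map_trmx; apply: unitarymxP. Qed.

Lemma norm_unitarymx_le1 m n (S : 'M[C]_(m, n)) i j :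
  S \is unitarymx -> `|S i j| <= 1.
Proof.
move=> /unitary_gram_mxP/matrixP/(_ i i); rewrite !mxE eqxx => rowS.
rewrite -(@expr_le1 _ 2) // -[leRHS]rowS (bigD1 j) //= !mxE -normCK.
by rewrite lerDl sumr_ge0 // => l _; rewrite !mxE -normCK exprn_ge0.
Qed.

Lemma norm_mulmx_ctrmx_unitary_le m p n (X : 'M[C]_(m, n)) (S : 'M_(p, n)) i j :
  S \is unitarymx -> `|(X *m ctrmx S) i j| <= \sum_l `|X i l|.
Proof.
move=> S_unitary; rewrite mxE; apply: le_trans (ler_norm_sum _ _ _) _.
by apply: ler_sum => l _; rewrite normrM !mxE norm_conjC ler_piMr ?norm_unitarymx_le1.
Qed.

Lemma gram_mx_mulmx_unitary m p n (P : 'M[C]_(m, p)) (S : 'M_(p, n)) :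
  S \is unitarymx -> gram_mx (P *m S) = gram_mx P.
Proof.
move=> /unitary_gram_mxP SS.
by rewrite /gram_mx ctrmxM mulmxA -(mulmxA P) -/(gram_mx S) SS mulmx1.
Qed.

Lemma gram_mx_col_ortho m1 m2 n (X : 'M[C]_(m1, n)) (A : 'M_(m2, n)) :
  A *m ctrmx X = 0 ->
  gram_mx (col_mx X A) = block_mx (gram_mx X) 0 0 (gram_mx A).
Proof.
move=> AX; have XA : X *m ctrmx A = 0 by rewrite -[X]ctrmxK -ctrmxM AX ctrmx0.
by rewrite /gram_mx ctrmx_col_mx mul_col_row AX XA.
Qed.

Lemma det_gram_mx_real m n (A : 'M[C]_(m, n)) : \det (gram_mx A) \is Num.real.
Proof. by rewrite CrealE -det_map_mx -det_tr -/(ctrmx _) ctrmxM ctrmxK. Qed.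

Lemma det_gram_mx_mull m n (L : 'M[C]_m) (A : 'M[C]_(m, n)) :
  \det (gram_mx (L *m A)) = `|\det L| ^+ 2 * \det (gram_mx A).
Proof.
rewrite /gram_mx ctrmxM mulmxA -(mulmxA L) !det_mulmx /ctrmx det_tr det_map_mx.
by rewrite normCK mulrAC.
Qed.

Lemma det_gram_mx_not_free m n (A : 'M[C]_(m, n)) :
  ~~ row_free A -> \det (gram_mx A) = 0.
Proof.
move=> nfA; apply/eqP; apply: contraR nfA => detA.
have := mxrankM_maxl A (ctrmx A); rewrite mxrank_unit ?unitmxE ?unitfE //.
by rewrite /row_free eqn_leq rank_leq_row.
Qed.

Lemma exists_orthonormal_complement a p k (A : 'M[C]_(a, k)) :
  (p + \rank A <= k)%N ->
  exists2 S : 'M[C]_(p, k), S \is unitarymx & A *m ctrmx S = 0.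
Proof.
move=> le_pk; pose O := kermx (ctrmx A).
have le_pO : (p <= \rank O)%N.
  by rewrite mxrank_ker mxrank_tr mxrank_map leq_subRL ?rank_leq_col // addnC.
pose S := schmidt (row_base O).
have S_unitary : S \is unitarymx by rewrite schmidt_unitarymx ?rank_leq_col.
have SA : S *m ctrmx A = 0.
  apply/sub_kermxP; rewrite -/O (eqmx_schmidt_free (row_base_free O)).
  by rewrite eq_row_base.
exists (pid_mx p *m S).
  apply: mul_unitarymx => //; apply/unitarymxP.
  by rewrite tr_pid_mx map_pid_mx mul_pid_mx minnn (minn_idPr le_pO) pid_mx_1.
by rewrite ctrmxM mulmxA -[A]ctrmxK -ctrmxM SA ctrmx0 mul0mx.
Qed.

Lemma ortho_decomposition n a p k (X : 'M[C]_(n, k)) (A : 'M_(a, k)) (S : 'M_(p, k)) :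
  (a + p = k)%N -> row_free A -> S \is unitarymx -> A *m ctrmx S = 0 ->
  exists Q, X = X *m ctrmx S *m S + Q *m A.
Proof.
move=> apk /eqP rA S_unitary AS.
have AS0 : (A :&: S = 0)%MS.
  by apply: orthomx_disj; apply/orthomx1P; rewrite -map_trmx.
have full : row_full (A + S)%MS.
  by rewrite /row_full mxrank_disjoint_sum // rA mxrank_unitary // apk.
have /sub_addsmxP[[Q P] /= XE] := submx_full X full; exists Q.
rewrite [in RHS]XE mulmxDl -!mulmxA AS mulmx0 add0r.
by rewrite [S *m ctrmx S](unitary_gram_mxP _ S_unitary) mulmx1 addrC -XE.
Qed.

Lemma det_gram_mx_col n a p k (X : 'M[C]_(n, k)) (A : 'M_(a, k)) (S : 'M_(p, k)) :
  (a + p = k)%N -> S \is unitarymx -> A *m ctrmx S = 0 ->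
  \det (gram_mx (col_mx X A)) =
    \det (gram_mx (X *m ctrmx S)) * \det (gram_mx A).
Proof.
move=> apk S_unitary AS; have [freeA|nfreeA] := boolP (row_free A); last first.
  rewrite (det_gram_mx_not_free nfreeA) mulr0 det_gram_mx_not_free //.
  by apply: contra nfreeA; apply: row_free_col_mxr.
have [Q XE] := ortho_decomposition X apk freeA S_unitary AS.
set P := X *m ctrmx S in XE *.
have -> : col_mx X A = block_mx 1%:M Q 0 1%:M *m col_mx (P *m S) A.
  by rewrite mul_block_col !mul1mx mul0mx add0r -XE.
rewrite det_gram_mx_mull det_ublock !det1 mulr1 normr1 expr1n mul1r.
rewrite gram_mx_col_ortho; last by rewrite ctrmxM mulmxA AS mul0mx.
by rewrite det_ublock (gram_mx_mulmx_unitary P S_unitary).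
Qed.

Lemma norm_det_gram_mx_le n p (Z : 'M[C]_(n, p)) (c : C) :
  (forall i j, `|Z i j| <= c) ->
  `|\det (gram_mx Z)| <= n`!%:R * (p%:R * c ^+ 2) ^+ n.
Proof.
move=> leZ; apply: norm_det_le => i j; rewrite mxE (le_trans (ler_norm_sum _ _ _)) //.
rewrite -[p in leRHS]card_ord mulr_natl -sumr_const; apply: ler_sum => l _.
by rewrite !mxE normrM norm_conjC expr2 ler_pM.
Qed.

End GramDeterminant.

(* The order need not be archimedean, so the bin is found by induction on the
   number of bins rather than with a floor function. *)
Lemma real_bin (R : numDomainType) (f : nat -> R) (T : nat) (y : R) :
  (forall t, f t \is Num.real) -> y \is Num.real -> f 0%N <= y <= f T.+1 ->
  exists t : 'I_T.+1, f t <= y <= f t.+1.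
Proof.
move=> f_real y_real; elim: T => [|T IHT] /andP[le0y leyT].
  by exists ord0; rewrite le0y.
have [yT|Ty] := real_leP y_real (f_real T.+1); last by exists ord_max; rewrite ltW.
have [|t yt] := IHT; first by rewrite le0y.
by exists (widen_ord (leqnSn _) t).
Qed.

Lemma real_pigeonhole (R : numFieldType) (I J : finType) (F : I -> J -> R)
    (M : R) (T : nat) :
  (forall i j, F i j \is Num.real) -> (forall i j, `|F i j| <= M) ->
  (0 < T)%N -> (T ^ #|J| < #|I|)%N ->
  exists i1 i2, i1 != i2 /\ forall j, `|F i1 j - F i2 j| <= 2 * M / T%:R.
Proof.
move=> F_real F_le; case: T => // T _ ltJI; set h := 2 * M / T.+1%:R.
pose f (t : nat) := - M + t%:R * h.
have bin i j : exists t : 'I_T.+1, f t <= F i j <= f t.+1.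
  have M_real : M \is Num.real by apply/ger0_real/(le_trans _ (F_le i j)).
  apply: real_bin => // [t|].
    by rewrite realD ?realN // !realM ?realV ?realn.
  rewrite /f mul0r addr0 [_ * h]mulrC divfK ?pnatr_eq0 //.
  by rewrite mulr_natl mulr2n addrA addNr add0r -real_ler_norml.
pose g i : {ffun J -> 'I_T.+1} := [ffun j => xchoose (bin i j)].
have /injectivePn[i1 [i2 ne12 eqg]] : ~~ injectiveb g.
  by apply/injectiveP => /leq_card; rewrite card_ffun card_ord leqNgt ltJI.
exists i1, i2; split=> // j.
have same_bin : xchoose (bin i2 j) = xchoose (bin i1 j).
  by move/ffunP: eqg => /(_ j); rewrite !ffunE.
have := xchooseP (bin i1 j); have := xchooseP (bin i2 j); rewrite same_bin.
move: (xchoose _) => t /andP[lo2 up2] /andP[lo1 up1].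
have -> : h = f t.+1 - f t by rewrite /f; ring.
by rewrite real_ler_norml ?realB // opprB !lerB.
Qed.

Section ComplexPigeonhole.
Variable C : numClosedFieldType.
Implicit Types z : C.

Lemma normC_le_ReIm z : `|z| <= `|'Re z| + `|'Im z|.
Proof.
by rewrite [in leLHS](Crect z) (le_trans (ler_normD _ _)) // normrM normCi mul1r.
Qed.

Lemma normC_Im_le z : `|'Im z| <= `|z|.
Proof.
rewrite -(@ler_pXn2r _ 2) ?nnegrE // [leRHS]normC2_Re_Im real_normK ?Creal_Im //.
by rewrite lerDr -real_normK ?Creal_Re ?exprn_ge0.
Qed.

Lemma complex_pigeonhole (I J : finType) (F : I -> J -> C) (M : C) (T : nat) :
  (forall i j, `|F i j| <= M) -> (0 < T)%N -> (T ^ (2 * #|J|) < #|I|)%N ->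
  exists i1 i2, i1 != i2 /\ forall j, `|F i1 j - F i2 j| <= 4 * M / T%:R.
Proof.
move=> F_le T_gt0 ltJI.
pose G i (jb : J * bool) := if jb.2 then 'Re (F i jb.1) else 'Im (F i jb.1).
have G_real i jb : G i jb \is Num.real.
  by rewrite /G; case: ifP => _; rewrite ?Creal_Re ?Creal_Im.
have G_le i jb : `|G i jb| <= M.
  apply: le_trans (F_le i jb.1); rewrite /G.
  by case: ifP => _; rewrite ?leif_normC_Re_Creal ?normC_Im_le.
have [|i1 [i2 [ne12 leG]]] := real_pigeonhole G_real G_le T_gt0.
  by rewrite card_prod card_bool mulnC.
exists i1, i2; split=> // j; apply: le_trans (normC_le_ReIm _) _.
have -> : 4 * M / T%:R = 2 * M / T%:R + 2 * M / T%:R by rewrite -!mulrDl -natrD.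
by rewrite !raddfB lerD ?(leG (j, true)) ?(leG (j, false)).
Qed.

End ComplexPigeonhole.

Lemma exists_root_bracket (q m : nat) : (0 < q)%N -> (1 < m)%N ->
  exists T, [/\ (0 < T)%N, (T ^ q < m)%N & (m <= T.+1 ^ q)%N].
Proof.
move=> q_gt0 m_gt1; have exT : exists T, (m <= T.+1 ^ q)%N.
  by exists m; rewrite (leq_trans (leqnSn m)) // -[leqLHS]expn1 leq_pexp2l.
case: (ex_minnP exT) => -[|T] leT minT; first by rewrite exp1n leqNgt m_gt1 in leT.
by exists T.+1; split; rewrite // ltnNge; apply/negP => /minT; rewrite ltnn.
Qed.

Section SiegelLemma.
Variables (C : numClosedFieldType) (I J : finType) (v : I -> J -> C) (c : C).
Hypothesis v_le : forall j, \sum_i `|v i j| <= c.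

Lemma norm_nat_combination_le (N : nat) (b : {ffun I -> 'I_N.+1}) j :
  `|\sum_i (b i)%:R * v i j| <= N%:R * c.
Proof.
rewrite (le_trans (ler_norm_sum _ _ _)) //.
apply: le_trans (ler_wpM2l (ler0n _ N) (v_le j)); rewrite mulr_sumr.
by apply: ler_sum => i _; rewrite normrM normr_nat ler_wpM2r // ler_nat -ltnS.
Qed.

Lemma siegel_pigeonhole (N T : nat) :
  (0 < T)%N -> (T ^ (2 * #|J|) < N.+1 ^ #|I|)%N ->
  exists b : {ffun I -> int}, [/\ b != 0, forall i, (absz (b i) <= N)%N &
    forall j, `|\sum_i (b i)%:~R * v i j| <= 4 * (N%:R * c) / T%:R].
Proof.
move=> T_gt0 ltT; pose L (b : {ffun I -> 'I_N.+1}) j := \sum_i (b i)%:R * v i j.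
have [|b1 [b2 [ne12 leL]]] := complex_pigeonhole (@norm_nat_combination_le N) T_gt0.
  by rewrite card_ffun card_ord.
exists [ffun i => (b1 i)%:Z - (b2 i)%:Z]; split=> [|i|j].
- apply: contraNneq ne12 => /ffunP eq12; apply/eqP/ffunP => i; apply/val_inj.
  by have /eqP := eq12 i; rewrite !ffunE subr_eq0 => /eqP[].
- by rewrite ffunE; have := ltn_ord (b1 i); have := ltn_ord (b2 i); lia.
apply: le_trans (leL j); rewrite -sumrB.
by under eq_bigr => i _ do rewrite ffunE rmorphB mulrBl.
Qed.

Lemma siegel_lemma (N : nat) : (0 < #|I|)%N -> (0 < #|J|)%N -> (0 < N)%N ->
  exists b : {ffun I -> int}, [/\ b != 0, forall i, (absz (b i) <= N)%N &
    forall j, `|\sum_i (b i)%:~R * v i j| <=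
      8 * c * ratpow N%:R (1 - #|I|%:R / (2 * #|J|)%:R)].
Proof.
move=> I_gt0 J_gt0 N_gt0; have J2_gt0 : (0 < 2 * #|J|)%N by rewrite muln_gt0.
have [|T [T_gt0 ltT geT]] := @exists_root_bracket _ (N.+1 ^ #|I|) J2_gt0.
  by rewrite -(exp1n #|I|) ltn_exp2r.
have [b [b_neq0 b_le leb]] := siegel_pigeonhole T_gt0 ltT.
exists b; split=> // j; apply: le_trans (leb j) _.
have N0 : 0 < N%:R :> C by rewrite ltr0n.
have c_ge0 : 0 <= c by apply: le_trans (v_le j); rewrite sumr_ge0.
have root_le : ratpow N%:R (#|I|%:R / (2 * #|J|)%:R) <= (2 * T)%:R :> C.
  rewrite ler_ratpowl // -!natrX ler_nat; apply: leq_trans (leq_trans geT _).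
    by rewrite leq_exp2r.
  by rewrite leq_exp2r // mul2n -addnn -addn1 leq_add2l.
rewrite ratpowB // ratpow1 // [leRHS]mulrA ler_pdivrMr ?ltr0n //.
rewrite mulrAC ler_pdivlMr ?ratpow_gt0 //.
apply: le_trans (ler_wpM2l _ root_le) _; first by rewrite !mulr_ge0 ?ler0n.
by rewrite [leRHS](_ : _ = 4 * (N%:R * c) * (2 * T)%:R) //; ring.
Qed.

End SiegelLemma.

Section LatticeCodes.
Variable C : numClosedFieldType.

Lemma int_combination_neq0 m p r (B : 'I_r -> 'M[C]_(m, p)) (b : {ffun 'I_r -> int}) :
  real_lin_indep B -> b != 0 -> \sum_i (b i)%:~R *: B i != 0.
Proof.
move=> indepB; apply: contraNneq => sum0; apply/eqP/ffunP => i; rewrite ffunE.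
by apply/eqP; rewrite -(@intr_eq0 C) (indepB _ _ sum0) // => j; apply: realz.
Qed.

Lemma exists_small_proj n p k r (B : 'I_r -> 'M[C]_(n, k)) :
  (0 < n)%N -> (0 < p)%N -> (0 < r)%N -> real_lin_indep B ->
  exists M : C, 0 < M /\ forall (S : 'M[C]_(p, k)) (N : nat),
    S \is unitarymx -> (0 < N)%N ->
    exists X : 'M[C]_(n, k), [/\ X != 0, in_box B N X &
      forall i j, `|(X *m ctrmx S) i j| <=
        M * ratpow N%:R (1 - r%:R / (2 * (n * p))%:R)].
Proof.
move=> n_gt0 p_gt0 r_gt0 indepB; pose c := 1 + \sum_l \sum_i \sum_z `|B l i z|.
have c_gt0 : 0 < c.
  by rewrite ltr_wpDr // !sumr_ge0 // => ? _; do 2![rewrite sumr_ge0 // => ? _].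
exists (8 * c); split=> [|S N S_unitary N_gt0]; first by rewrite mulr_gt0.
pose v l (ij : 'I_n * 'I_p) := (B l *m ctrmx S) ij.1 ij.2.
have v_le ij : \sum_l `|v l ij| <= c.
  apply: ler_wpDl => //; apply: ler_sum => l _.
  apply: le_trans (norm_mulmx_ctrmx_unitary_le _ _ _ S_unitary) _.
  by rewrite (bigD1 ij.1) //= lerDl; do 2![rewrite sumr_ge0 // => ? _].
have [|||b [b_neq0 b_le b_small]] := @siegel_lemma C _ _ v c v_le N.
- by rewrite card_ord.
- by rewrite card_prod !card_ord muln_gt0 n_gt0.
- exact: N_gt0.
exists (\sum_l (b l)%:~R *: B l).
split=> [||i j]; [exact: int_combination_neq0 | by exists b |].
have := b_small (i, j); rewrite card_prod !card_ord; apply: le_trans.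
rewrite mulmx_suml summxE.
by under eq_bigr => l _ do rewrite -scalemxAl mxE.
Qed.

Lemma exists_small_det_gram_proj n p k r (B : 'I_r -> 'M[C]_(n, k)) :
  (0 < n)%N -> (0 < p)%N -> (0 < r)%N -> real_lin_indep B ->
  exists c : C, 0 < c /\ forall (S : 'M[C]_(p, k)) (N : nat),
    S \is unitarymx -> (0 < N)%N ->
    exists X : 'M[C]_(n, k), [/\ X != 0, in_box B N X &
      `|\det (gram_mx (X *m ctrmx S))| <=
        c * ratpow N%:R ((2 * n)%:R - r%:R / p%:R)].
Proof.
move=> n_gt0 p_gt0 r_gt0 indepB.
have [M [M_gt0 small]] := exists_small_proj n_gt0 p_gt0 r_gt0 indepB.
exists (n`!%:R * (p%:R * M ^+ 2) ^+ n); split=> [|S N S_unitary N_gt0].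
  by rewrite !(mulr_gt0, exprn_gt0) ?ltr0n ?fact_gt0.
have [X [X_neq0 boxX leX]] := small S N S_unitary N_gt0.
exists X; split=> //; apply: le_trans (norm_det_gram_mx_le leX) _.
have -> : (2 * n)%:R - r%:R / p%:R = (1 - r%:R / (2 * (n * p))%:R) *+ (2 * n) :> rat.
  by rewrite -[RHS]mulr_natr; field; rewrite !pnatr_eq0 -!lt0n p_gt0.
rewrite ratpowMn ?ltr0n // exprM -[leRHS]mulrA -exprMn -[X in _ <= _ * X ^+ _]mulrA.
by rewrite -exprMn.
Qed.

Definition in_code U n k r (B : 'I_U -> 'I_r -> 'M[C]_(n, k)) (N : 'I_U -> nat)
    (X : 'I_U -> 'M[C]_(n, k)) : Prop :=
  forall j, X j != 0 /\ in_box (B j) (N j) (X j).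

Definition ord_cons (T : Type) U (x : T) (X : 'I_U -> T) (j : 'I_U.+1) : T :=
  oapp X x (unlift ord0 j).

Lemma gram_det_cons U n k (x : 'M[C]_(n, k)) (X : 'I_U -> 'M[C]_(n, k)) :
  gram_det (ord_cons x X) = \det (gram_mx (col_mx x (stack X))).
Proof.
rewrite /gram_det /stack mxcol_recu /=.
(* Once [big_ord_recl] is applied, the cast is along an equality [m = m]. *)
move: mxsize_recl; rewrite big_ord_recl => eq_size; rewrite castmx_id.
congr (\det (gram_mx (col_mx _ _))); first by rewrite /ord_cons unlift_none.
by apply/eq_mxcol => j; rewrite /ord_cons liftK.
Qed.

Lemma in_code_cons U n k r (B : 'I_U.+1 -> 'I_r -> 'M[C]_(n, k)) N x X :
  x != 0 -> in_box (B ord0) (N ord0) x ->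
  in_code (fun j => B (lift ord0 j)) (fun j => N (lift ord0 j)) X ->
  in_code B N (ord_cons x X).
Proof.
move=> x_neq0 boxx codeX j; rewrite /ord_cons.
by case: unliftP => [i ->|->] //=; apply: codeX.
Qed.

Lemma exists_small_gram_det U n k r (B : 'I_U -> 'I_r -> 'M[C]_(n, k)) :
  (0 < n)%N -> (0 < r)%N -> (U * n <= k)%N -> (forall j, real_lin_indep (B j)) ->
  exists K : C, 0 < K /\ forall N : 'I_U -> nat, (forall j, (0 < N j)%N) ->
    exists X, in_code B N X /\ `|gram_det X| <=
      K * \prod_(l < U)
        ratpow (N l)%:R ((2 * n)%:R - r%:R / (k - n * (U - l.+1))%:R).
Proof.
move=> n_gt0 r_gt0; elim: U B => [|U IHU] B leUk indepB.
  exists 1; split=> // N _; exists (fun _ => 0); split=> [[]//|].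
  rewrite big_ord0 /gram_det; move: (stack _); rewrite big_ord0 => A.
  by rewrite det_mx00 normr1 mulr1.
have [|K [K_gt0 small_tail]] := IHU (fun j => B (lift ord0 j)) _ (fun j => indepB _).
  by lia.
pose a := (\sum_(j < U) n)%N; pose p := (k - n * U)%N.
have aE : a = (n * U)%N by rewrite /a sum_nat_const card_ord mulnC.
have apk : (a + p = k)%N by lia.
have p_gt0 : (0 < p)%N by lia.
have [c [c_gt0 small_head]] :=
  exists_small_det_gram_proj n_gt0 p_gt0 r_gt0 (indepB ord0).
exists (c * K); split=> [|N N_gt0]; first exact: mulr_gt0.
have [Y [codeY leY]] := small_tail (fun j => N (lift ord0 j)) (fun j => N_gt0 _).
have [|S S_unitary YS] := @exists_orthonormal_complement C a p k (stack Y).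
  by rewrite -[leqRHS]apk addnC leq_add2r rank_leq_row.
have [X [X_neq0 boxX leX]] := small_head S (N ord0) S_unitary (N_gt0 _).
exists (ord_cons X Y); split; first exact: in_code_cons.
rewrite gram_det_cons (det_gram_mx_col _ apk S_unitary YS) normrM.
rewrite big_ord_recl mulrACA.
by rewrite subSS subn0 ler_pM.
Qed.

Lemma oppr_expo U n k l : (0 < n)%N -> (U * n <= k)%N -> (l < U)%N ->
  - expo U n k l = (2 * n)%:R - (2 * k * n)%:R / (k - n * (U - l.+1))%:R.
Proof.
move=> n_gt0 leUk ltlU; rewrite /expo; set p := (k - _)%N.
have p_neq0 : p%:R != 0 :> rat by rewrite pnatr_eq0 /p; nia.
have kE : (k = n * (U - l.+1) + p)%N by rewrite /p; nia.
by rewrite [in RHS]kE; field.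
Qed.

Lemma expo_last U n k l : (U <= l.+1)%N -> expo U n k l = 0.
Proof. by rewrite /expo -subn_eq0 => /eqP->; rewrite muln0 mul0r. Qed.

Lemma prod_ratpow_expo U n k (x : 'I_U -> C) : (forall l, 0 < x l) ->
  \prod_(l < U) ratpow (x l) (- expo U n k l) =
    \prod_(l < U | (l.+1 < U)%N) ratpow (x l) (- expo U n k l).
Proof.
move=> x_gt0; rewrite [RHS]big_mkcond; apply: eq_bigr => l _; case: ltnP => // leUl.
by rewrite expo_last // oppr0 ratpow0.
Qed.

Lemma decay_le_norm_gram_det U n k r (B : 'I_U -> 'I_r -> 'M[C]_(n, k)) N d X :
  is_decay B N d -> in_code B N X -> d <= `|gram_det X|.
Proof.
move=> [_ min_d] /min_d le_d; apply: le_trans le_d _.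
exact: real_ler_norm (det_gram_mx_real _).
Qed.

End LatticeCodes.

Theorem theorem2p3 (C : numClosedFieldType) (U n k : nat)
  (hU : (1 <= U)%N) (hn : (1 <= n)%N) (hk : (U * n <= k)%N)
  (B : 'I_U -> 'I_(2 * k * n) -> 'M[C]_(n, k))
  (hB : forall j, real_lin_indep (B j)) :
  exists K : C, 0 < K /\
    (forall (N : 'I_U -> nat), (forall j, (0 < N j)%N) ->
      forall d, is_decay B N d ->
        d <= K * \prod_(l < U | (l.+1 < U)%N) ratpow (N l)%:R (- expo U n k l)) /\
    (forall (N : nat), (0 < N)%N ->
      forall d, is_decay B (fun _ => N) d ->
        d <= K / ratpow N%:R (\sum_(l < U | (l.+1 < U)%N) expo U n k l)).
Proof.
have [|K [K_gt0 small]] := exists_small_gram_det hn _ hk hB; first by nia.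
have decay_le N (N_gt0 : forall j, (0 < N j)%N) d : is_decay B N d ->
    d <= K * \prod_(l < U | (l.+1 < U)%N) ratpow (N l)%:R (- expo U n k l).
  have [X [codeX leX]] := small N N_gt0.
  move=> /decay_le_norm_gram_det/(_ codeX)/le_trans; apply.
  rewrite -prod_ratpow_expo => [|l]; last by rewrite ltr0n.
  by under eq_bigr => l _ do rewrite oppr_expo //.
exists K; split=> //; split=> // N N_gt0 d /(decay_le _ (fun _ => N_gt0)).
by rewrite -ratpowN ?ltr0n // -sumrN ratpow_sum ?ltr0n.
Qed.
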